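(* For every integer $n\ge0$, $A_3(n)=C_{3,3}(n)$, where $A_3(n)$ is the number of partitions $\lambda$ of $n$ for which there exists an integer $j\ge 0$ such that $m_{2i-1}(\lambda)=2$ for every $1\le i\le j$ and every part of $\lambda$ greater than $2j$ has multiplicity at most $1$ (i.e., if $2j-1$ is the largest repeated odd part, then all positive odd integers less than $2j$ appear exactly twice and no part greater than $2j$ is repeated; even parts at most $2j$ are unrestricted), and $C_{3,3}(n)$ is the number of partitions of $n$ into parts $\not\equiv 0,\pm3\pmod 7$.
   Context: $m_j(\lambda)$ denotes the number of times $j$ appears as a part of the partition $\lambda$. *)

(* Defs.v *)
From Stdlib Require Import ClassicalEpsilon.
From mathcomp Require Import all_boot.
Set Implicit Arguments. Unset Strict Implicit. Unset Printing Implicit Defensive.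

(* A partition of n is encoded by its multiplicity vector:
   m : {ffun 'I_n.+1 -> 'I_n.+1}, where m k is the number of times the
   part k (1 <= k <= n) occurs; m ord0 = 0 (no part 0) and
   \sum_k k * m k = n.  This encoding is a bijection with the partitions
   of n (every part is <= n and every multiplicity is <= n). *)
Definition ptn (n : nat) := {ffun 'I_n.+1 -> 'I_n.+1}.

Definition is_partition (n : nat) (m : ptn n) : bool :=
  (nat_of_ord (m ord0) == 0) && (\sum_(k < n.+1) k * m k == n).

Definition mult (n : nat) (m : ptn n) (j : nat) : nat :=
  if j < n.+1 then nat_of_ord (m (inord j)) else 0.

Definition asbool (P : Prop) : bool :=
  if excluded_middle_informative P then true else false.

Definition A3_cond (n : nat) (m : ptn n) : Prop :=
  exists j : nat,
    (forall i : nat, 1 <= i <= j -> mult m (2 * i - 1) = 2) /\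
    (forall k : nat, 2 * j < k -> mult m k <= 1).

Definition C33_cond (n : nat) (m : ptn n) : Prop :=
  forall k : nat, 0 < mult m k ->
    ~ (k %% 7 = 0 \/ k %% 7 = 3 \/ k %% 7 = 4).

Definition A3 (n : nat) : nat :=
  #|[pred m : ptn n | is_partition m && asbool (A3_cond m)]|.

Definition C33 (n : nat) : nat :=
  #|[pred m : ptn n | is_partition m && asbool (C33_cond m)]|.

(* Main.v *)
(* The integer j of the condition defining A_3 is unique, so
   sum_n A_3(n) q^n = sum_j q^(2j^2) (-q^(2j+1);q)_oo / (q^2;q^2)_j,
   and the claim is the first Rogers-Selberg identity modulo 7.

   Replace q^(2j^2) and (-q^(2j+1);q)_oo by x^(2j) q^(2j^2) and
   (-xq^(2j+1);q)_oo to get S_3(x), and let S_2(x) carry an extra factor q^(2j).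
   Then S_2(x) = S_3(xq) + xq S_2(xq) and S_3(x) = S_2(x) + x^2 q^2 S_3(xq^2).
   Selberg's well-poised series
     sum_n (-1)^n x^(3n) q^(7n(n+1)/2 - in) (1 - x^i q^((2n+1)i)) / ((q)_n (xq^(n+1))_oo)
   for i = 3, 2 satisfy the same system, by telescoping in n.  Evaluated at
   x = q^m, the system determines its solution by downward induction on m, since
   everything is 1 modulo q^N when m >= N.  So the two sides agree at x = 1, where
   the well-poised series is summed by the Jacobi triple product.

   Power series are replaced by elements of a commutative ring in which q^N = 0,
   eventually Z[X]/(X^(n+1)). *)
From Stdlib Require Import ClassicalEpsilon.
Require Import Defs.
From mathcomp Require Import all_boot.
From mathcomp Require Import all_algebra qpoly ring zify.
Import GRing.Theory.
Set Implicit Arguments. Unset Strict Implicit. Unset Printing Implicit Defensive.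

(** * The Rogers-Selberg identity modulo q^N *)

Section NilpotentSeries.
Local Open Scope ring_scope.

Variables (R : comNzRingType) (q : R) (N : nat).
Hypothesis qN : q ^+ N = 0.

Lemma expr_eq0_ge n : (N <= n)%N -> q ^+ n = 0.
Proof. by move=> le_Nn; rewrite -(subnKC le_Nn) exprD qN mul0r. Qed.

(** The inverse of [1 - q ^+ k] for [k > 0]: their product telescopes to [1 - q ^+ (k * N)], which
    is 1. *)
Definition geom (k : nat) : R := \sum_(0 <= i < N) q ^+ (k * i).

Lemma geomE k : (0 < k)%N -> (1 - q ^+ k) * geom k = 1.
Proof.
move=> k_gt0; rewrite /geom mulr_sumr (telescope_sumr_eq (fun i => - q ^+ (k * i))) //.
  by rewrite muln0 expr0 expr_eq0_ge ?leq_pmull // oppr0 opprK add0r.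
by move=> i _; rewrite mulnS exprD; ring.
Qed.

Definition pos_prod (a : nat) : R := \prod_(a <= t < N) (1 + q ^+ t).

Lemma pos_prod_recl a : pos_prod a = (1 + q ^+ a) * pos_prod a.+1.
Proof.
rewrite /pos_prod; have [lt_aN | le_Na] := ltnP a N; first by rewrite big_ltn.
by rewrite !big_geq ?expr_eq0_ge ?addr0 ?mulr1 // ltnW.
Qed.

Definition qp (d j : nat) : R := \prod_(0 <= l < j) (1 - q ^+ (d * l.+1)).
Definition inv_qp (d j : nat) : R := \prod_(0 <= l < j) geom (d * l.+1).

Lemma inv_qpS d j : (0 < d)%N ->
  (1 - q ^+ (d * j.+1)) * inv_qp d j.+1 = inv_qp d j.
Proof.
by move=> d_gt0; rewrite /inv_qp big_nat_recr //= mulrCA geomE ?mulr1 // muln_gt0 d_gt0.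
Qed.

(* The series [S_3] and [S_2] at [x = q^m]. *)
Definition sel3 (m : nat) : R :=
  \sum_(0 <= j < N) q ^+ (2 * m * j + 2 * j ^ 2) * inv_qp 2 j * pos_prod (m + 2 * j).+1.
Definition sel2 (m : nat) : R :=
  \sum_(0 <= j < N) q ^+ (2 * m * j + 2 * j ^ 2 + 2 * j) * inv_qp 2 j * pos_prod (m + 2 * j).+1.

(** * The functional equations of the sum side and the uniqueness of their solution *)

Lemma sel2_rec m : sel2 m = sel3 m.+1 + q ^+ m.+1 * sel2 m.+1.
Proof.
rewrite /sel2 /sel3 mulr_sumr -big_split; apply: eq_bigr => j _ /=.
rewrite pos_prod_recl.
have -> : (2 * m.+1 * j + 2 * j ^ 2 = 2 * m * j + 2 * j ^ 2 + 2 * j)%N by ring.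
have -> : (m.+1 + 2 * j = (m + 2 * j).+1)%N by lia.
by rewrite -addSn !exprD; ring.
Qed.

(** The factor [1 - q ^+ (2 * j)] of the difference kills [j = 0] and cancels the last factor of
    [inv_qp 2 j]; then [j] is shifted, the top term being 0 by nilpotence. *)
Lemma sel3_rec m : sel3 m = sel2 m + q ^+ (2 * m.+1) * sel3 m.+2.
Proof.
suff: sel3 m - sel2 m = q ^+ (2 * m.+1) * sel3 m.+2 by move=> <-; ring.
rewrite /sel2 /sel3 -sumrB.
case eN: N => [|M]; first by rewrite !big_geq // mulr0.
rewrite big_nat_recl // big_nat_recr //= !muln0 !addn0 subrr add0r.
rewrite mulrDr !mulrA -exprD.
rewrite [q ^+ (_ + (_ * M + _))]expr_eq0_ge ?mul0r ?addr0; last by rewrite eN -mulnn; nia.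
rewrite mulr_sumr; apply: eq_bigr => j _; rewrite !mulrA -exprD -[inv_qp 2 j](@inv_qpS 2) //.
have -> : (m.+2 + 2 * j = m + 2 * j.+1)%N by lia.
have -> : (2 * m.+1 + (2 * m.+2 * j + 2 * j ^ 2) = 2 * m * j.+1 + 2 * j.+1 ^ 2)%N by ring.
by rewrite (exprD q _ (2 * j.+1)); ring.
Qed.

Lemma sel3_large m : (0 < N)%N -> (N <= m)%N -> sel3 m = 1.
Proof.
move=> N_gt0 le_Nm; rewrite /sel3 big_ltn // big_nat_cond big1 => [|j /andP[]].
  rewrite !muln0 expr0 /inv_qp big_geq // /pos_prod big_geq ?mulr1 ?addr0 //.
  by rewrite addn0 leqW.
by move=> /andP[j_gt0 _] _; rewrite expr_eq0_ge ?mul0r //; nia.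
Qed.

Lemma sel2_large m : (0 < N)%N -> (N <= m)%N -> sel2 m = 1.
Proof.
move=> N_gt0 le_Nm; rewrite /sel2 big_ltn // big_nat_cond big1 => [|j /andP[]].
  rewrite !muln0 expr0 /inv_qp big_geq // /pos_prod big_geq ?mulr1 ?addr0 //.
  by rewrite addn0 leqW.
by move=> /andP[j_gt0 _] _; rewrite expr_eq0_ge ?mul0r //; nia.
Qed.

Lemma selberg_system_unique (A B A' B' : nat -> R) :
    (forall m, B m = A m.+1 + q ^+ m.+1 * B m.+1) ->
    (forall m, A m = B m + q ^+ (2 * m.+1) * A m.+2) ->
    (forall m, B' m = A' m.+1 + q ^+ m.+1 * B' m.+1) ->
    (forall m, A' m = B' m + q ^+ (2 * m.+1) * A' m.+2) ->
    (forall m, (N <= m)%N -> A m = A' m) ->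
    (forall m, (N <= m)%N -> B m = B' m) ->
  forall m, A m = A' m.
Proof.
move=> recB recA recB' recA' eqA eqB m.
suff eqAB d k : (N - k <= d)%N -> A k = A' k /\ B k = B' k.
  by have [] := eqAB _ m (leqnn _).
elim: d k => [|d IHd] k le_d.
  by split; [apply: eqA | apply: eqB]; lia.
have [eqA1 eqB1] : A k.+1 = A' k.+1 /\ B k.+1 = B' k.+1 by apply: IHd; lia.
have [eqA2 _] : A k.+2 = A' k.+2 /\ B k.+2 = B' k.+2 by apply: IHd; lia.
by rewrite recA recA' recB recB' eqA1 eqB1 eqA2.
Qed.

(** * Selberg's well-poised series *)

Definition qpoch (m n : nat) : R := \prod_(0 <= l < m) (1 - q ^+ (n + l).+1).

Lemma qpochSr m n : qpoch m.+1 n = qpoch m n * (1 - q ^+ (m + n).+1).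
Proof. by rewrite /qpoch big_nat_recr //= addnC. Qed.

Lemma qpochSl m n : qpoch m.+1 n = (1 - q ^+ n.+1) * qpoch m n.+1.
Proof.
rewrite /qpoch big_nat_recl // addn0; congr (_ * _).
by apply: eq_bigr => l _; rewrite addnS.
Qed.

(* The [n]-th term of the [i]-th well-poised series at [x = q^m], multiplied by
   [(q)_oo] so that the denominators turn into the polynomial [qpoch m n]; the
   exponent [7n(n+1)/2 - in] is written as [7 'C(n, 2) + (7 - i)n]. *)
Definition wp_term (i m n : nat) : R :=
  (-1) ^+ n * q ^+ (3 * m * n + 7 * 'C(n, 2)) * q ^+ ((7 - i) * n)
  * (1 - q ^+ (i * (m + 2 * n).+1)) * qpoch m n.
Definition wp (i m : nat) : R := \sum_(0 <= n < N) wp_term i m n.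

(** Up to common factors, the [n]-th terms of [wp i.+1 m] and [wp i m] differ by q^(-(i+1)n) (1 -
    q^n) + q^(i(m+n+1)) (1 - q^(m+n+1)). The first summand gives [g n]; the second, combined with
    the term of [wp (3 - i) m.+1], gives [- g n.+1]. *)
Lemma wp_rec i m : (i < 3)%N ->
  wp i.+1 m = wp i m + q ^+ (i * m.+1) * wp (3 - i) m.+1.
Proof.
move=> lt_i3.
pose g n := (-1) ^+ n * q ^+ (3 * m * n + 7 * 'C(n, 2)) * q ^+ ((6 - i) * n) * (1 - q ^+ n)
  * qpoch m n.
suff: wp i.+1 m - wp i m - q ^+ (i * m.+1) * wp (3 - i) m.+1 = 0.
  by move/eqP; rewrite -addrA -opprD subr_eq0 => /eqP.
rewrite /wp mulr_sumr -!sumrB.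
rewrite (telescope_sumr_eq (fun n => - g n)) // => [|n _].
  (* [g] vanishes at 0 through [1 - q ^+ 0] and at [N] by nilpotence. *)
  rewrite /g expr0 subrr mulr0 mul0r oppr0 subr0 (expr_eq0_ge (n := (6 - i) * N)).
    by rewrite mulr0 !mul0r oppr0.
  by rewrite leq_pmull // subn_gt0; lia.
rewrite opprK addrC {}/g /wp_term.
have e1 : (3 * m * n.+1 + 7 * 'C(n.+1, 2) = 3 * m * n + 7 * 'C(n, 2) + 3 * m + 7 * n)%N.
  by rewrite binS bin1; ring.
have e2 : (3 * m.+1 * n + 7 * 'C(n, 2) = 3 * m * n + 7 * 'C(n, 2) + 3 * n)%N by ring.
rewrite e1 e2; move: (3 * m * n + 7 * 'C(n, 2))%N => c.
rewrite -(mulrA _ (1 - q ^+ n.+1)) -qpochSl qpochSr.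
have expE k a : q ^+ (k * a) = (q ^+ a) ^+ k by rewrite mulnC exprM.
rewrite !expE !(exprS q) !exprD !expr0 (exprS (-1)).
by case: i lt_i3 => [|[|[|]]] // _ /=; ring.
Qed.

Lemma wp0 m : wp 0 m = 0.
Proof. by rewrite /wp big1 // => n _; rewrite /wp_term mul0n subrr mulr0 mul0r. Qed.

Lemma wp_large i m : (0 < i <= 3)%N -> (0 < N)%N -> (N <= m)%N -> wp i m = qpoch N 0.
Proof.
move=> /andP[i_gt0 le_i3] N_gt0 le_Nm; rewrite /wp big_ltn // big_nat_cond big1 => [|n /andP[]].
  rewrite /wp_term !muln0 !expr0 !mul1r addr0 (expr_eq0_ge (n := i * _)) ?subr0 ?mul1r; last by nia.
  rewrite /qpoch (big_cat_nat _ le_Nm) //= [X in _ * X = _](_ : _ = 1) ?mulr1 //.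
  rewrite big_nat_cond big1 // => l /andP[/andP[le_Nl _] _].
  by rewrite expr_eq0_ge ?subr0 //; lia.
by move=> /andP[n_gt0 _] _; rewrite /wp_term (expr_eq0_ge (n := _ + _)) ?mulr0 ?mul0r //; nia.
Qed.

Lemma rogers_selberg_wp m : (0 < N)%N -> qpoch N 0 * sel3 m = wp 3 m.
Proof.
move=> N_gt0.
(* Since [wp 0] vanishes, [wp 1] is a shift of [wp 3], which closes the system on [wp 3] and
   [wp 2]. *)
have wp1 k : wp 1 k = wp 3 k.+1 by rewrite wp_rec // wp0 mul0n expr0 add0r mul1r.
apply: (selberg_system_unique (A := fun k => qpoch N 0 * sel3 k)
  (B := fun k => qpoch N 0 * sel2 k) (B' := wp 2)) => k.
- by rewrite sel2_rec; ring.
- by rewrite sel3_rec; ring.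
- by rewrite wp_rec // wp1 mul1n.
- by rewrite wp_rec // wp1.
- by move=> le_Nk; rewrite sel3_large // mulr1 wp_large.
- by move=> le_Nk; rewrite sel2_large // mulr1 wp_large.
Qed.

(** * Gaussian binomials and the Jacobi triple product *)

Lemma qpS d j : qp d j.+1 = qp d j * (1 - q ^+ (d * j.+1)).
Proof. by rewrite /qp big_nat_recr. Qed.

Lemma qpK d j : (0 < d)%N -> qp d j * inv_qp d j = 1.
Proof.
move=> d_gt0; elim: j => [|j IHj]; first by rewrite /qp /inv_qp !big_geq ?mulr1.
by rewrite qpS -mulrA inv_qpS.
Qed.

Lemma sum_nilp_trunc (F : nat -> R) M :
  (N <= M)%N -> (forall i, (N <= i)%N -> F i = 0) ->
  \sum_(0 <= i < M) F i = \sum_(0 <= i < N) F i.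
Proof.
move=> le_NM F0; rewrite (big_cat_nat _ le_NM) //= [X in _ + X = _]big_nat_cond.
by rewrite [X in _ + X = _]big1 ?addr0 // => i /andP[/andP[/F0]].
Qed.

Lemma prod_nilp_trunc (P : pred nat) (F : nat -> R) a M :
  (a <= N)%N -> (N <= M)%N -> (forall i, (N <= i)%N -> F i = 1) ->
  \prod_(a <= i < M | P i) F i = \prod_(a <= i < N | P i) F i.
Proof.
move=> le_aN le_NM F1; rewrite (big_cat_nat le_aN le_NM) /= [X in _ * X = _]big_nat_cond.
by rewrite [X in _ * X = _]big1 ?mulr1 // => i /andP[/andP[/F1]].
Qed.

Lemma qp_large d j : (0 < d)%N -> (N <= j)%N -> qp d j = qp d N.
Proof.
move=> d_gt0 le_Nj; rewrite /qp prod_nilp_trunc // => i le_Ni.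
by rewrite expr_eq0_ge ?subr0 //; nia.
Qed.

Lemma inv_qp_large d j : (0 < d)%N -> (N <= j)%N -> inv_qp d j = inv_qp d N.
Proof.
move=> d_gt0 le_Nj; rewrite -[LHS]mul1r -(qpK N d_gt0) mulrAC.
by rewrite -(qp_large d_gt0 le_Nj) qpK // mul1r.
Qed.

(** The Gaussian binomial of [a + b] over [a] in base [q ^+ d]. *)
Definition gauss (d a b : nat) : R := qp d (a + b) * inv_qp d a * inv_qp d b.

Lemma gaussC d a b : gauss d a b = gauss d b a.
Proof. by rewrite /gauss addnC mulrAC. Qed.

Lemma gauss0 d a : (0 < d)%N -> gauss d a 0 = 1.
Proof.
by move=> d_gt0; rewrite /gauss addn0 qpK // /inv_qp big_geq ?mulr1.
Qed.

Lemma gauss_pascal d a b : (0 < d)%N ->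
  gauss d a.+1 b.+1 = gauss d a.+1 b + q ^+ (d * b.+1) * gauss d a b.+1.
Proof.
move=> d_gt0; rewrite /gauss -(inv_qpS a d_gt0) -(inv_qpS b d_gt0).
rewrite addSn addnS qpS; have -> : (d * (a + b).+2 = d * a.+1 + d * b.+1)%N by ring.
by rewrite exprD; ring.
Qed.

Lemma gauss_large d a b : (0 < d)%N -> (N <= a)%N -> (N <= b)%N ->
  gauss d a b = inv_qp d N.
Proof.
move=> d_gt0 le_Na le_Nb; rewrite /gauss qp_large ?(leq_trans le_Na) ?leq_addr //.
by rewrite !inv_qp_large // qpK // mul1r.
Qed.

(** One induction step of the q-binomial theorem: the q-Pascal rule splits the sum in two, and the
    hypothesis on [f] makes the second part [z] times the first. *)
Lemma gauss_sum_step d M z (f : nat -> R) : (0 < d)%N ->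
  (forall k, (k <= M)%N -> q ^+ (d * (M - k)) * f k.+1 = z * f k) ->
  \sum_(0 <= k < M.+2) gauss d k (M.+1 - k) * f k
    = (1 + z) * \sum_(0 <= k < M.+1) gauss d k (M - k) * f k.
Proof.
move=> d_gt0 fE; rewrite big_nat_recr //= big_nat_recl //= !subnn !subn0.
rewrite mulrDl mul1r mulr_sumr.
rewrite [X in _ = X + _]big_nat_recl // [X in _ = _ + X]big_nat_recr //= subn0 subnn.
rewrite !(gaussC _ 0) !gauss0 // !mul1r -fE // subnn muln0 expr0 mul1r.
rewrite !addrA; congr (_ + _); rewrite -!addrA; congr (_ + _); rewrite -big_split.
rewrite big_nat_cond [RHS]big_nat_cond; apply: eq_bigr => k /andP[/andP[_ lt_kM] _] /=.
rewrite subSS mulrCA -fE; last exact: ltnW.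
by rewrite -[(M - k)%N](subnSK lt_kM) gauss_pascal //; ring.
Qed.

(* One of the truncated differences vanishes, so this is the coefficient of
   index [k - m] (an integer) of the theta series, with [y] playing the role of
   [q^d / x]. *)
Definition jacobi_coef (d : nat) (x y : R) (m k : nat) : R :=
  (- x) ^+ (k - m) * q ^+ (d * 'C(k - m, 2)) * ((- y) ^+ (m - k) * q ^+ (d * 'C(m - k, 2))).

(** The relation [x * y = q ^+ d] makes the ratio of consecutive coefficients follow one formula on
    both sides of [k = m]. *)
Lemma jacobi_coef_step d x y n m k : x * y = q ^+ d -> (k <= n + m)%N ->
  q ^+ (d * (n + m - k)) * jacobi_coef d x y m k.+1
    = - (x * q ^+ (d * n)) * jacobi_coef d x y m k.
Proof.
move=> xy le_k; rewrite /jacobi_coef; case: (leqP m k) => [le_mk | lt_km].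
  have -> : (m - k = 0)%N by lia.
  have -> : (m - k.+1 = 0)%N by lia.
  have -> : (k.+1 - m = (k - m).+1)%N by lia.
  rewrite exprS binS bin1 mulnDr exprD.
  have -> : (d * n = d * (n + m - k) + d * (k - m))%N by rewrite -mulnDr; congr muln; lia.
  by rewrite exprD; ring.
have -> : (k - m = 0)%N by lia.
have -> : (k.+1 - m = 0)%N by lia.
have -> : (m - k = (m - k.+1).+1)%N by lia.
have -> : (n + m - k = n + 1 + (m - k.+1))%N by lia.
by rewrite binS bin1 !mulnDr muln1 !exprD !exprS -xy; move: ((- y) ^+ _) => u; ring.
Qed.

Lemma finite_jacobi_step d x y n m : (0 < d)%N -> x * y = q ^+ d ->
  \sum_(0 <= k < (n + m).+1) gauss d k (n + m - k) * jacobi_coef d x y m k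
  = \prod_(0 <= i < n) (1 - x * q ^+ (d * i))
    * \sum_(0 <= k < m.+1) gauss d k (m - k) * jacobi_coef d x y m k.
Proof.
move=> d_gt0 xy; elim: n => [|n IHn]; first by rewrite big_geq ?mul1r.
rewrite addSn (gauss_sum_step (z := - (x * q ^+ (d * n)))) // => [|k le_k].
  by rewrite IHn [\prod_(0 <= i < n.+1) _]big_nat_recr //= mulrA (mulrC (1 + _)).
exact: (jacobi_coef_step xy le_k).
Qed.

(** [finite_jacobi_step] peels off the factors in [x]; reversing the remaining sum exchanges [x] and
    [y], so the same lemma peels off the others. *)
Lemma finite_jacobi d x y n m : (0 < d)%N -> x * y = q ^+ d ->
  \prod_(0 <= i < n) (1 - x * q ^+ (d * i)) * \prod_(0 <= i < m) (1 - y * q ^+ (d * i))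
  = \sum_(0 <= k < (n + m).+1) gauss d k (n + m - k) * jacobi_coef d x y m k.
Proof.
move=> d_gt0 xy; rewrite finite_jacobi_step //; congr (_ * _).
have yx : y * x = q ^+ d by rewrite mulrC.
have := finite_jacobi_step m 0 d_gt0 yx; rewrite addn0 big_nat1 gauss0 //.
have -> : jacobi_coef d y x 0 0 = 1 by rewrite /jacobi_coef !expr0 bin0n muln0 !mulr1.
rewrite !mulr1 => <-; rewrite [RHS]big_nat_rev /=.
rewrite big_nat_cond [RHS]big_nat_cond; apply: eq_bigr => k /andP[/andP[_ le_km] _].
rewrite add0n subSS subKn // gaussC; congr (_ * _).
rewrite /jacobi_coef subn0 subKn //.
have -> : (m - k - m = 0)%N by lia.
have -> : (0 - k = 0)%N by lia.
by rewrite mulrC.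
Qed.

Lemma jacobi_triple d a b : (0 < a)%N -> (0 < b)%N -> (a + b = d)%N ->
  qp d N * \prod_(0 <= i < 2 * N) (1 - q ^+ (d * i + a))
    * \prod_(0 <= i < 2 * N) (1 - q ^+ (d * i + b))
  = \sum_(0 <= n < N) (-1) ^+ n * (q ^+ (d * 'C(n, 2) + a * n) - q ^+ (d * 'C(n.+1, 2) + b * n.+1)).
Proof.
move=> a_gt0 b_gt0 abd; have d_gt0 : (0 < d)%N by lia.
have xy : q ^+ a * q ^+ b = q ^+ d by rewrite -exprD abd.
have qE c i : q ^+ (d * i + c) = q ^+ c * q ^+ (d * i) by rewrite addnC exprD.
under eq_bigr => i _ do rewrite qE.
under [X in _ * X]eq_bigr => i _ do rewrite qE.
rewrite -mulrA finite_jacobi // mulr_sumr.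
transitivity (\sum_(0 <= k < (2 * N + 2 * N).+1) jacobi_coef d (q ^+ a) (q ^+ b) (2 * N) k).
  apply: eq_big_nat => k /andP[_ lt_k]; rewrite mulrA.
  (* Near the centre [2 * N] the binomial has its limit value 1/(q^d; q^d)_oo, which cancels
     [qp d N]; elsewhere [k] is more than [N] away from the centre and the coefficient vanishes. *)
  have [/andP[le1 le2] | far] := boolP ((N <= k) && (N <= 2 * N + 2 * N - k))%N.
    by rewrite gauss_large // qpK // mul1r.
  rewrite /jacobi_coef; move: far; rewrite negb_and -!ltnNge => /orP[] lt_N.
    rewrite [(- q ^+ b) ^+ _]exprNn -!exprM [q ^+ (b * _)]expr_eq0_ge; last by nia.
    by rewrite !(mulr0, mul0r).
  rewrite [(- q ^+ a) ^+ _]exprNn -!exprM [q ^+ (a * _)]expr_eq0_ge; last by nia.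
  by rewrite !(mulr0, mul0r).
have le_N2 : (2 * N <= (2 * N + 2 * N).+1)%N by lia.
rewrite (big_cat_nat _ le_N2) //= big_nat_rev /= addrC.
rewrite -{1}[(2 * N)%N]add0n big_addn.
have -> : ((2 * N + 2 * N).+1 - 2 * N = (2 * N).+1)%N by lia.
under [in RHS]eq_bigr do rewrite mulrBr.
rewrite sumrB -sumrN -(sum_nilp_trunc (M := (2 * N).+1)); last first.
- by move=> i le_Ni; rewrite expr_eq0_ge ?mulr0 //; nia.
- by lia.
rewrite -(sum_nilp_trunc (M := (2 * N)) (F := fun i => - (_ * _))); last first.
- by move=> i le_Ni; rewrite expr_eq0_ge ?mulr0 ?oppr0 //; nia.
- by lia.
congr (_ + _).
  apply: eq_bigr => n _; rewrite /jacobi_coef addnK.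
  have -> : (2 * N - (n + 2 * N) = 0)%N by lia.
  by rewrite !expr0 bin0n muln0 !mulr1 [(- q ^+ a) ^+ n]exprNn -exprM exprD; ring.
apply: eq_big_nat => n /andP[_ lt_n]; rewrite /jacobi_coef add0n.
have -> : (2 * N - n.+1 - 2 * N = 0)%N by lia.
have -> : (2 * N - (2 * N - n.+1) = n.+1)%N by lia.
rewrite !expr0 bin0n muln0 !mul1r [(- q ^+ b) ^+ n.+1]exprNn -exprM exprD (exprS (-1)).
by ring.
Qed.

(** * The product side modulo 7 *)

Lemma wp_jacobi : (0 < N)%N ->
  wp 3 0 = qp 7 N * \prod_(0 <= i < 2 * N) (1 - q ^+ (7 * i + 4))
    * \prod_(0 <= i < 2 * N) (1 - q ^+ (7 * i + 3)).
Proof.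
move=> N_gt0; rewrite jacobi_triple //; apply: eq_bigr => n _.
rewrite /wp_term /qpoch big_geq // mulr1 muln0 mul0n add0n -!mulrA; congr (_ * _).
rewrite mulrA -exprD mulrBr mulr1 -exprD binS bin1.
by congr (_ - q ^+ _); lia.
Qed.

Definition mod7_034 (l : nat) := (l %% 7 \in [:: 0; 3; 4])%N.

Lemma prod_mod7_034 (F : nat -> R) K :
  \prod_(1 <= l < (7 * K).+1 | mod7_034 l) F l
  = \prod_(0 <= i < K) (F (7 * i.+1)%N * F (7 * i + 4)%N * F (7 * i + 3)%N).
Proof.
elim: K => [|K IHK]; first by rewrite !big_geq.
rewrite [RHS]big_nat_recr //= -IHK.
rewrite (big_cat_nat (n := (7 * K).+1)) //=; last by lia.
congr (_ * _); rewrite -{1}[(7 * K).+1]add0n big_addn.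
have -> : ((7 * K.+1).+1 - (7 * K).+1 = 7)%N by lia.
under eq_bigl => r.
  rewrite /mod7_034 addnS -addSn addnC mulnC modnMDl; over.
rewrite big_mkcond /index_iota /= !big_cons big_nil /= !mul1r mulr1.
have -> : (2 + (7 * K).+1 = 7 * K + 3)%N by lia.
have -> : (3 + (7 * K).+1 = 7 * K + 4)%N by lia.
have -> : (6 + (7 * K).+1 = 7 * K.+1)%N by lia.
by ring.
Qed.

Lemma sel3_prod : (0 < N)%N -> sel3 0 = \prod_(1 <= l < N | ~~ mod7_034 l) geom l.
Proof.
move=> N_gt0.
have one_large l : (N <= l)%N -> 1 - q ^+ l = 1.
  by move=> le_Nl; rewrite expr_eq0_ge ?subr0.
have qpochE : qpoch N 0 = \prod_(1 <= l < N) (1 - q ^+ l).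
  by rewrite -(@prod_nilp_trunc _ _ 1 N.+1) // big_add1.
have badE : wp 3 0 = \prod_(1 <= l < N | mod7_034 l) (1 - q ^+ l).
  (* Factors of index at least [N] are 1, so the range may be extended to whole blocks of 7. *)
  rewrite -(@prod_nilp_trunc _ _ 1 (7 * (2 * N)).+1) //; last by lia.
  rewrite prod_mod7_034 !big_split /= wp_jacobi // -(@qp_large _ (2 * N)) //; lia.
have geomK (P : pred nat) :
    \prod_(1 <= l < N | P l) (1 - q ^+ l) * \prod_(1 <= l < N | P l) geom l = 1.
  rewrite -big_split /= big_nat_cond big1 // => l /andP[/andP[l_gt0 _] _].
  exact: geomE.
have := rogers_selberg_wp 0 N_gt0; rewrite badE qpochE.
rewrite (bigID mod7_034) /= => selE.
have bK := geomK mod7_034; have gK := geomK (fun l => ~~ mod7_034 l).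
move: bK gK selE; move: (\prod_(_ <= _ < _ | _) _) (\prod_(_ <= _ < _ | _) _) => b' b bK.
move: (\prod_(_ <= _ < _ | _) _) (\prod_(_ <= _ < _ | _) _) => g' g gK selE.
transitivity (b * b' * (g * g') * sel3 0); first by rewrite bK gK !mul1r.
transitivity (b * g * sel3 0 * b' * g'); first by ring.
by rewrite selE bK mul1r.
Qed.

(** * The sum side: for fixed [j], one generating-function factor per part size *)

Definition a3_factor (j k : nat) : R :=
  if (2 * j < k)%N then 1 + q ^+ k
  else if odd k then q ^+ (2 * k) else geom k.

(** The odd parts contribute 2(1 + 3 + ... + (2i - 1)) = 2i^2 to the exponent, and the even ones
    give [inv_qp 2 i]. *)
Lemma a3_factor_small j i : (i <= j)%N ->
  \prod_(1 <= k < (2 * i).+1) a3_factor j k = q ^+ (2 * i ^ 2) * inv_qp 2 i.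
Proof.
elim: i => [|i IHi] lt_ij; first by rewrite big_geq // /inv_qp big_geq ?mulr1.
have -> : (2 * i.+1 = (2 * i).+2)%N by lia.
rewrite big_nat_recr // big_nat_recr //= IHi 1?ltnW //.
have -> : a3_factor j (2 * i).+1 = q ^+ (2 * (2 * i).+1).
  by rewrite /a3_factor ifF /= ?oddM //; lia.
have -> : a3_factor j (2 * i).+2 = geom (2 * i).+2.
  by rewrite /a3_factor ifF /= ?oddM //; lia.
rewrite /inv_qp [in RHS]big_nat_recr //= -!mulrA.
have -> : (2 * i.+1 ^ 2 = 2 * i ^ 2 + 2 * (2 * i).+1)%N by ring.
have -> : (2 * i.+1 = (2 * i).+2)%N by lia.
by rewrite exprD; ring.
Qed.

Lemma sel3_0E : sel3 0 = \sum_(0 <= j < N | (2 * j <= N)%N) \prod_(1 <= k < N) a3_factor j k.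
Proof.
rewrite /sel3 [RHS]big_mkcond /=; apply: eq_big_nat => j /andP[_ lt_jN].
(* For [2 * j > N] the left term vanishes, whereas the product stopped below [N] would miss the
   factor of the odd part [2 * j - 1]; hence the filter. *)
rewrite muln0 mul0n !add0n; case: leqP => [le_jN | lt_Nj]; last first.
  by rewrite expr_eq0_ge ?mul0r // -mulnn; nia.
rewrite -(a3_factor_small (leqnn j)).
(* If [2 * j = N], the missing factor at [N] is [geom N], equal to 1 because [q ^+ N = 0]. *)
move: le_jN; rewrite leq_eqVlt => /orP[/eqP eqN | lt_jN2].
  rewrite eqN /pos_prod [X in _ * X]big_geq ?mulr1 // big_nat_recr /=; last by lia.
  have -> : a3_factor j N = geom N by rewrite /a3_factor eqN ltnn -eqN oddM.
  rewrite [X in _ * X](_ : _ = 1) ?mulr1 //.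
  by rewrite -[LHS]mul1r -[X in X * _](subr0 1) -qN geomE //; lia.
rewrite [RHS](big_cat_nat (n := (2 * j).+1)) //=; congr (_ * _).
rewrite /pos_prod; apply: eq_big_nat => k /andP[lt_jk _].
by rewrite /a3_factor lt_jk.
Qed.

Theorem rogers_selberg_mod7 : (0 < N)%N ->
  \sum_(0 <= j < N | (2 * j <= N)%N) \prod_(1 <= k < N) a3_factor j k
  = \prod_(1 <= l < N | ~~ mod7_034 l) geom l.
Proof. by move=> N_gt0; rewrite -sel3_0E sel3_prod. Qed.

End NilpotentSeries.

(** * Counting partitions by multiplicity constraints *)

Section Counting.

Import Pdiv.CommonRing Pdiv.RingMonic.

Variable n : nat.
Implicit Types (m : ptn n) (P : nat -> nat -> bool).

Definition part_sat P m := [forall k : 'I_n.+1, (0 < k) ==> P k (m k)].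

Lemma part_satP P m :
  reflect (forall k, 0 < k <= n -> P k (mult m k)) (part_sat P m).
Proof.
apply: (iffP forallP) => [satm k /andP[k_gt0 le_kn] | satm k].
  by have := satm (inord k); rewrite /mult ltnS le_kn inordK // k_gt0.
apply/implyP => k_gt0; have := satm k; rewrite k_gt0 -ltnS ltn_ord.
by rewrite /mult ltn_ord inord_val; apply.
Qed.

Definition count_ptn P := #|[pred m : ptn n | is_partition m && part_sat P m]|.

Local Open Scope ring_scope.

Definition part_gf P : {poly int} :=
  \prod_(1 <= k < n.+1) \sum_(0 <= i < n.+1 | P k i) 'X^(k * i).

(** Distributing the product over the sums yields one monomial per multiplicity vector, whose
    exponent is the sum of the parts. *)
Lemma count_ptn_coef P : (count_ptn P)%:R = (part_gf P)`_n.
Proof.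
(* [P0] adds an index 0 whose factor is 1, encoding [m ord0 = 0]. *)
pose P0 (k i : nat) := if k is 0 then i == 0%N else P k i.
have -> : part_gf P = \prod_(k < n.+1) \sum_(i < n.+1 | P0 k i) 'X^(k * i).
  rewrite -(big_mkord xpredT (fun k => \sum_(i < n.+1 | P0 k i) 'X^(k * i))).
  rewrite big_ltn // (big_pred1 ord0) // mul0n expr0 mul1r.
  by apply: eq_big_nat => -[] // k _; rewrite big_mkord.
rewrite bigA_distr_big_dep coef_sum /count_ptn -sum1_card natr_sum.
rewrite big_mkcond [RHS]big_mkcond; apply: eq_bigr => m _ /=.
rewrite prodrXr coefXn inE /is_partition.
have -> : (m \in family (fun k : 'I_n.+1 => [pred i : 'I_n.+1 | P0 k i]))
    = ((m ord0 == 0%N :> nat) && part_sat P m).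
  apply/familyP/andP => [fam | [m0 /forallP sat] k].
    split; first exact: (fam ord0).
    by apply/forallP => -[[|k] lt_k] //; apply: (fam (Ordinal lt_k)).
  case: k => [[|k] lt_k]; rewrite inE /=; last exact: (implyP (sat (Ordinal lt_k))).
  by rewrite (_ : Ordinal lt_k = ord0) //; apply: val_inj.
by rewrite [n == _]eq_sym andbAC; case: (_ && part_sat P m); case: (_ == n).
Qed.

Definition trunc_ring := {poly %/ ('X^(n.+1) : {poly int})}.

Lemma qX_nilp : ('qX : trunc_ring) ^+ n.+1 = 0.
Proof.
rewrite /qpolyX -rmorphXn; apply: val_inj => /=.
by rewrite mk_monic_Xn rmodpp ?monicXn.
Qed.

Lemma coef_in_qpoly (f g : {poly int}) :
  in_qpoly 'X^(n.+1) f = in_qpoly 'X^(n.+1) g -> f`_n = g`_n.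
Proof.
have coefE (p : {poly int}) : p`_n = (rmodp p 'X^(n.+1))`_n.
  by rewrite {1}(rdivp_eq (monicXn _ n.+1) p) coefD coefMXn ltnSn add0r.
by move/(congr1 val) => /=; rewrite mk_monic_Xn /= => eq_fg; rewrite coefE eq_fg -coefE.
Qed.

Lemma in_qpoly_part_gf P :
  in_qpoly 'X^(n.+1) (part_gf P)
  = \prod_(1 <= k < n.+1) \sum_(0 <= i < n.+1 | P k i) ('qX : trunc_ring) ^+ (k * i).
Proof.
rewrite rmorph_prod; apply: eq_bigr => k _; rewrite rmorph_sum.
by apply: eq_bigr => i _; rewrite rmorphXn.
Qed.

(** * The two partition conditions as multiplicity rules *)

Definition C33_rule (k i : nat) := (0 < i)%N ==> ~~ mod7_034 k.

Definition A3_rule (j k i : nat) :=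
  if (2 * j < k)%N then (i <= 1)%N else odd k ==> (i == 2)%N.

Lemma C33_rule_gf :
  in_qpoly 'X^(n.+1) (part_gf C33_rule)
  = \prod_(1 <= l < n.+1 | ~~ mod7_034 l) geom ('qX : trunc_ring) n.+1 l.
Proof.
rewrite in_qpoly_part_gf [RHS]big_mkcond; apply: eq_bigr => k _ /=.
rewrite /C33_rule /geom; case: (mod7_034 k) => /=.
  rewrite big_ltn_cond //= big_nat_cond big_pred0 ?muln0 ?addr0 // => i.
  by case: i => [|i]; rewrite ?andbF.
by apply: eq_bigl => i; rewrite implybT.
Qed.

Lemma A3_rule_gf j :
  in_qpoly 'X^(n.+1) (part_gf (A3_rule j))
  = \prod_(1 <= k < n.+1) a3_factor ('qX : trunc_ring) n.+1 j k.
Proof.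
rewrite in_qpoly_part_gf; apply: eq_big_nat => k /andP[k_gt0 lt_kn].
have qN := qX_nilp; move: ('qX) qN => q qN.
rewrite /A3_rule /a3_factor; case: ifP => _.
  rewrite big_ltn_cond //= muln0 expr0; congr (_ + _).
  rewrite big_ltn_cond //=; last by lia.
  rewrite muln1 big_nat_cond big_pred0 ?addr0 // => i.
  by case: i => [|[|i]]; rewrite ?andbF.
(* For [n <= 1] the multiplicity 2 is out of range and the sum is empty; [q ^+ (2 * k)] is then 0 as
   well. *)
case: (odd k) => //=; rewrite big_nat1_eq mulnC; case: ltnP => // le_n2.
by rewrite (expr_eq0_ge qN) //; nia.
Qed.

Lemma count_C33_rule : count_ptn C33_rule = C33 n.
Proof.
apply: eq_card => m; rewrite !inE; apply: andb_id2l => /andP[/eqP m0 _].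
rewrite /asbool; case: excluded_middle_informative => [condm | ncondm].
  apply/part_satP => k _; apply/implyP => /condm nk.
  by apply/negP => mod_k; apply: nk; move: mod_k; rewrite /mod7_034 !inE => /or3P[]/eqP; auto.
apply/negP => /part_satP satm; apply: ncondm => k mk_gt0 mod_k.
(* The value 0 has a forbidden residue, but [m ord0 = 0] excludes it. *)
have k_gt0 : (0 < k)%N.
  case: k mk_gt0 {mod_k} => //; rewrite /mult /= (_ : inord 0%N = ord0) ?m0 //.
  by apply: val_inj; rewrite /= inordK.
have le_kn : (k <= n)%N by move: mk_gt0; rewrite /mult; case: ifP.
have := satm k; rewrite k_gt0 le_kn /C33_rule mk_gt0 => /(_ isT) /negP; apply.
by rewrite /mod7_034 !inE; apply/or3P;
case: mod_k => [->|[->|->]]; [constructor 1|constructor 2|constructor 3].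
Qed.

Definition A3_cond_at j m : Prop :=
  (forall i, (1 <= i <= j)%N -> mult m (2 * i - 1) = 2%N) /\
  (forall k, (2 * j < k)%N -> (mult m k <= 1)%N).

(** If [i < j], the part [2 * i + 1] would occur at most once by [i] and exactly twice by [j]. *)
Lemma A3_cond_at_unique m i j : A3_cond_at i m -> A3_cond_at j m -> i = j.
Proof.
wlog lt_ij : i j / (i < j)%N => [wlog_lt | [_ le1] [eq2 _]].
  by case: (ltngtP i j) => // [/wlog_lt | /wlog_lt wl] h1 h2; [auto | rewrite wl].
have := eq2 i.+1; rewrite lt_ij => /(_ isT).
by have := le1 (2 * i.+1 - 1)%N; case: (mult _ _) => [|[|]] // t /(_ _) h; lia.
Qed.

Lemma A3_cond_at_bound m j : A3_cond_at j m -> (2 * j <= n.+1)%N.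
Proof.
case: j => // j [/(_ j.+1)]; rewrite leqnn => /(_ isT); rewrite /mult.
by case: ltnP => // lt_j _ _; lia.
Qed.

Lemma A3_ruleP j m : (2 * j <= n.+1)%N -> reflect (A3_cond_at j m) (part_sat (A3_rule j) m).
Proof.
move=> le_j; apply: (iffP (part_satP _ _)) => [satm | [eq2 le1] k /andP[k_gt0 le_kn]].
  split=> [i /andP[i_gt0 le_ij] | k lt_jk].
    have := satm (2 * i - 1)%N; rewrite /A3_rule ifF; last by lia.
    have -> : (2 * i - 1 = (2 * i.-1).+1)%N by lia.
    by rewrite /= oddM /= => /(_ _)/eqP; apply; lia.
  have [lt_nk | le_kn] := ltnP n k; first by rewrite /mult ltnNge lt_nk.
  by have := satm k; rewrite /A3_rule lt_jk; apply; lia.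
rewrite /A3_rule; case: ltnP => [/le1 // | le_kj]; apply/implyP => odd_k.
have -> : k = (2 * k./2.+1 - 1)%N by lia.
by rewrite eq2 //; lia.
Qed.

(* For [2j > n.+1] no partition qualifies, the part [2j - 1] being too large, but
   [A3_rule j] only inspects parts up to [n] and would not see it. *)
Lemma count_A3_rule :
  (A3 n = \sum_(0 <= j < n.+1 | 2 * j <= n.+1) count_ptn (A3_rule j))%N.
Proof.
rewrite /A3 -sum1_card big_mkcond /=.
under [RHS]eq_bigr do rewrite /count_ptn -sum1_card big_mkcond /=.
(* After the exchange, each partition contributes 1 exactly when some [j] fits, since that [j] is
   unique. *)
rewrite exchange_big /=; apply: eq_bigr => m _; rewrite inE.
under eq_bigr do rewrite inE.
case: (is_partition m) => /=; last by rewrite big1.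
rewrite /asbool; case: excluded_middle_informative => [[j condj] | ncond].
  have le_j := A3_cond_at_bound condj.
  rewrite -big_filter (bigD1_seq j) ?filter_uniq ?iota_uniq //; last first.
    by rewrite mem_filter le_j mem_index_iota; lia.
  rewrite (introT (A3_ruleP m le_j)) // big1_seq // => i /andP[ne_ij].
  rewrite mem_filter => /andP[le_i _]; case: A3_ruleP => // condi; move: ne_ij.
  by rewrite (A3_cond_at_unique condi condj) eqxx.
rewrite big1 // => j le_j; case: A3_ruleP => // condj.
by case: ncond; exists j.
Qed.

End Counting.

Theorem theorem5 (n : nat) : A3 n = C33 n.
Proof.
(* Both counts become coefficients of index [n], which survive reduction modulo X^(n+1); there the
   identity applies with [N = n.+1]. *)
apply/eqP; rewrite -(Num.Theory.eqr_nat int) -count_C33_rule count_A3_rule natr_sum.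
under eq_bigr do rewrite count_ptn_coef.
rewrite count_ptn_coef -coef_sum; apply/eqP/coef_in_qpoly.
rewrite rmorph_sum C33_rule_gf -(rogers_selberg_mod7 (qX_nilp n)) //.
by apply: eq_bigr => j _; apply: A3_rule_gf.
Qed.
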